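(* If a non-empty internal subset $\mathcal{A}$ of ${}^*\mathbb{R}$ is bounded from above (in ${}^*\mathbb{R}$), then $\sup\mathcal{A}$ exists in ${}^*\mathbb{R}$.
   Context: $\mathbb{R}_+$ is the set of positive real numbers and $\mathbb{N}=\{1,2,3,\dots\}$. Fix an ultrafilter $\mathcal{U}$ on $\mathbb{R}_+$ such that $(0,\tfrac1n)\in\mathcal{U}$ for all $n\in\mathbb{N}$. A property of $\varepsilon\in\mathbb{R}_+$ holds almost everywhere (a.e.) if the set of $\varepsilon$ for which it holds belongs to $\mathcal{U}$. For nets $(a_\varepsilon),(b_\varepsilon)\in\mathbb{C}^{\mathbb{R}_+}$ write $(a_\varepsilon)\sim(b_\varepsilon)$ if $a_\varepsilon=b_\varepsilon$ a.e.; $\langle a_\varepsilon\rangle$ is the equivalence class, and ${}^*\mathbb{C}=\mathbb{C}^{\mathbb{R}_+}/\!\sim$ with operations induced pointwise. ${}^*\mathbb{R}=\{\langle a_\varepsilon\rangle : a_\varepsilon\in\mathbb{R}\text{ a.e.}\}$, ordered by $\langle a_\varepsilon\rangle<\langle b_\varepsilon\rangle$ iff $a_\varepsilon<b_\varepsilon$ a.e. (a total order). A subset of ${}^*\mathbb{C}$ is internal if it is of the form $\langle S_\varepsilon\rangle=\{\langle z_\varepsilon\rangle\in{}^*\mathbb{C} : z_\varepsilon\in S_\varepsilon\text{ a.e.}\}$ for some family $(S_\varepsilon)_{\varepsilon\in\mathbb{R}_+}$ of subsets of $\mathbb{C}$. The supremum is the least upper bound with respect to the order of ${}^*\mathbb{R}$.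 *)

(* Defs.v *)
From HB Require Import structures.
From mathcomp Require Import all_boot all_order all_algebra.
From mathcomp Require Import all_classical all_reals.
From mathcomp Require Import interval_inference complex.

Set Implicit Arguments.
Unset Strict Implicit.
Unset Printing Implicit Defensive.

Import Order.TTheory GRing.Theory Num.Theory.
Local Open Scope classical_set_scope.
Local Open Scope ring_scope.
Local Open Scope complex_scope.
Local Open Scope quotient_scope.

Section StarC.
Context (R : realType) (U : set_system {posnum R}) (UU : UltraFilter U).

Definition net : Type := {posnum R} -> R[i].
HB.instance Definition _ := Choice.on net.

Definition neteq (a b : net) : bool := `[< U [set e | a e = b e] >].

Let FU : ProperFilter U := @ultra_proper _ _ UU.

Lemma neteq_refl : reflexive neteq.
Proof. by move=> a; apply/asboolP; apply: filterS (@filterT _ U _). Qed.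

Lemma neteq_sym : symmetric neteq.
Proof.
by move=> a b; apply/idP/idP => /asboolP h; apply/asboolP;
  apply: filterS h => e /= ->.
Qed.

Lemma neteq_trans : transitive neteq.
Proof.
move=> b a c /asboolP ab /asboolP bc; apply/asboolP.
by apply: filterS2 ab bc => e /= -> ->.
Qed.

Canonical neteq_equiv : equiv_rel net :=
  EquivRel neteq neteq_refl neteq_sym neteq_trans.

(* ^*C.  Only the filter axioms are needed to form this quotient; being
   ultra makes the order on ^*R below total. *)
Definition starC : Type := {eq_quot neteq_equiv}.
HB.instance Definition _ := Choice.on starC.

Definition star_class (a : net) : starC := \pi_({eq_quot neteq_equiv}) a.

Lemma star_classP (a b : net) :
  star_class a = star_class b <-> U [set e | a e = b e].
Proof.
split=> [/eqP|h]; first by rewrite /star_class eqmodE => /asboolP.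
by apply/eqP; rewrite /star_class eqmodE; apply/asboolP.
Qed.

Lemma star_class_surj (x : starC) : exists a, x = star_class a.
Proof. by exists (repr (x : {eq_quot neteq_equiv})); rewrite /star_class reprK. Qed.

(* Membership only asks for some representative z with z e in S e almost
   everywhere; as U is a filter, this holds for one representative iff it
   holds for all. *)
Definition internal_of (S : {posnum R} -> set R[i]) : set starC :=
  [set star_class z | z in [set z : net | U [set e | S e (z e)]]].

Definition internal (B : set starC) : Prop := exists S, B = internal_of S.

Definition real_classes : set starC :=
  [set star_class a | a in [set a : net | U [set e | a e \is Num.real]]].

(* ^*R as a subtype of ^*C, so that it can carry an order of its own. *)
Definition starR : Type := set_type real_classes.
HB.instance Definition _ := Choice.on starR.

Definition starR_val (x : starR) : starC := val x.

(* The nets are complex-valued, so < below is the partial order of R[i]; on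
   real elements it is the order of R. *)
Definition starR_lt (x y : starR) : bool :=
  `[< exists a b : net,
        [/\ starR_val x = star_class a, starR_val y = star_class b,
            U [set e | a e \is Num.real], U [set e | b e \is Num.real]
          & U [set e | a e < b e] ] >].

Lemma starR_rep (x : starR) :
  exists2 a : net, starR_val x = star_class a & U [set e | a e \is Num.real].
Proof. by case: x => x /= /[dup] /set_mem [a ha <-] ?; exists a. Qed.

Lemma starR_ltP (x y : starR) (a b : net) :
  starR_val x = star_class a -> starR_val y = star_class b ->
  reflect (U [set e | a e < b e]) (starR_lt x y).
Proof.
move=> xa yb; have ra : U [set e | a e \is Num.real].
  have [a' /[!xa] /star_classP aa'] := starR_rep x.
  by apply: filterS2 aa' => e /= ->.
have rb : U [set e | b e \is Num.real].
  have [b' /[!yb] /star_classP bb'] := starR_rep y.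
  by apply: filterS2 bb' => e /= ->.
rewrite /starR_lt; apply: (iffP (asboolP _)) => [[a' [b' []]]|ab]; last by exists a, b.
rewrite xa yb => /star_classP aa' /star_classP bb' _ _.
by apply: filterS3 aa' bb' => e /= -> ->.
Qed.

Lemma starR_lt_irr : irreflexive starR_lt.
Proof.
move=> x; have [a xa _] := starR_rep x.
apply/negP => /(starR_ltP xa xa) h; apply: (@filter_not_empty _ U _).
by apply: filterS h => e /=; rewrite ltxx.
Qed.

Lemma starR_lt_trans : transitive starR_lt.
Proof.
move=> y x z; have [a xa _] := starR_rep x; have [b yb _] := starR_rep y.
have [c zc _] := starR_rep z.
move=> /(starR_ltP xa yb) ab /(starR_ltP yb zc) bc; apply/(starR_ltP xa zc).
by apply: filterS2 ab bc => e /=; exact: lt_trans.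
Qed.

Lemma starR_lt_total (x y : starR) : x != y -> starR_lt x y || starR_lt y x.
Proof.
have [a xa ra] := starR_rep x; have [b yb rb] := starR_rep y.
move=> nxy; apply/orP.
have [ab|nab] := in_ultra_setVsetC [set e | a e < b e] UU.
  by left; apply/(starR_ltP xa yb).
have [ba|nba] := in_ultra_setVsetC [set e | b e < a e] UU.
  by right; apply/(starR_ltP yb xa).
case/eqP: nxy; apply: val_inj; rewrite -/(starR_val x) -/(starR_val y) xa yb.
apply/star_classP; apply: filterS2 (filterI nab nba) (filterI ra rb).
move=> e /= [/negP nab' /negP nba'] [are bre].
by have [ab|ba|//] := real_ltgtP are bre; rewrite ?ab ?ba in nab' nba'.
Qed.

Definition starR_le (x y : starR) : bool := (x == y) || starR_lt x y.

HB.instance Definition _ := Order.LtOrder.Build ring_display starR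
  (le := starR_le) (fun _ _ => erefl) (fun _ _ => erefl) (fun _ _ => erefl)
  starR_lt_irr starR_lt_trans starR_lt_total.

Lemma starR_ltE (x y : starR) : (x < y) = starR_lt x y.
Proof. by []. Qed.

Lemma starR_leE (x y : starR) : (x <= y) = (x == y) || starR_lt x y.
Proof. by []. Qed.

End StarC.

(* Main.v *)
(* Nets of reals represent the elements of ^*R; the supremum of an internal
   set with components [S e] is the class of the net of suprema of the real
   parts [T e] of the [S e].  The point is that an upper bound [u] of the
   internal set bounds [T e] for almost every [e]: otherwise, picking in almost
   every [T e] an element above [u e] gives an element of the internal set
   above [u]. *)
Require Import Defs.
From mathcomp Require Import all_boot all_order all_algebra.
From mathcomp Require Import all_classical all_reals.
From mathcomp Require Import interval_inference complex.

Import Order.TTheory GRing.Theory Num.Theory.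
Local Open Scope classical_set_scope.
Local Open Scope ring_scope.

Section RealNets.
Context {R : realType} {U : set_system {posnum R}} {UU : UltraFilter U}.
Implicit Types (t u : {posnum R} -> R) (x y : starR UU).

Let FU : ProperFilter U := @ultra_proper _ _ UU.

Definition real_net t : net R := fun e => (t e)%:C%C.

Definition starR_repr x t := starR_val x = star_class UU (real_net t).

Lemma starR_repr_ex x : exists t, starR_repr x t.
Proof.
(* The net [a] is real only almost everywhere; taking real parts changes it only off a set of [U],
   so its class is the same. *)
have [a xa ra] := starR_rep x; exists (fun e => complex.Re (a e)).
rewrite /starR_repr xa; apply/star_classP; apply: filterS ra => e /= ae.
by rewrite /real_net RRe_real.
Qed.

Lemma starR_repr_class t : exists x, starR_repr x t.
Proof.
have ht : star_class UU (real_net t) \in @real_classes R U UU.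
  apply/mem_set; exists (real_net t) => //=.
  by apply: filterS filterT => e _ /=; rewrite complex_real.
by exists (SigSub ht : starR UU).
Qed.

Lemma starR_repr_lt {x y t u} : starR_repr x t -> starR_repr y u ->
  x < y <-> U [set e | t e < u e].
Proof.
move=> xt yu; rewrite starR_ltE; split.
  by move=> /(starR_ltP xt yu); apply: filterS => e /=; rewrite ltcR.
by move=> tu; apply/(starR_ltP xt yu); apply: filterS tu => e /=; rewrite ltcR.
Qed.

(** As the order is total, the alternative is [y < x], which would put two contradictory
    inequalities on a common set of [U]. *)
Lemma starR_repr_le {x y t u} : starR_repr x t -> starR_repr y u ->
  U [set e | t e <= u e] -> x <= y.
Proof.
move=> xt yu tu.
have [-> //|/starR_lt_total/orP[xy|]] := eqVneq x y.
  by rewrite starR_leE xy orbT.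
rewrite -starR_ltE => /(starR_repr_lt yu xt) ut.
suff : U set0 by move/filter_not_empty.
by apply: filterS2 tu ut => e /= tu /(le_lt_trans tu); rewrite ltxx.
Qed.

Lemma internal_mem {A : set (starR UU)} {S x t} :
  [set starR_val x | x in A] = internal_of S -> starR_repr x t ->
  A x <-> U [set e | S e (t e)%:C%C].
Proof.
move=> AS xt; split=> [Ax|St].
  have : internal_of S (starR_val x) by rewrite -AS; exists x.
  move=> [z /= Sz]; rewrite xt => /star_classP zt.
  by apply: filterS2 Sz zt => e /= + zt; rewrite zt.
have : internal_of S (starR_val x) by exists (real_net t).
by rewrite -AS => -[y Ay /val_inj <-].
Qed.

Lemma internal_ubound {A : set (starR UU)} {S x t} :
  [set starR_val x | x in A] = internal_of S -> starR_repr x t ->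
  ubound A x -> U [set e | ubound [set r : R | S e r%:C%C] (t e)].
Proof.
move=> AS xt Ax.
(* As [U] is ultra, a bound that does not hold almost everywhere fails almost everywhere. *)
have [//|nub] := in_ultra_setVsetC
  [set e | ubound [set r : R | S e r%:C%C] (t e)] UU.
have /choice[u uP] e : exists r, ~ ubound [set r : R | S e r%:C%C] (t e) ->
    S e r%:C%C /\ t e < r.
  have [ub|nue] := pselect (ubound [set r : R | S e r%:C%C] (t e)).
    (* An arbitrary value: [u e] matters only where the bound fails, which is almost everywhere by
       [nub]. *)
    by exists 0.
  move/existsNP: nue => [r /not_implyP[Sr /negP]].
  by rewrite -ltNge => tr; exists r.
have [y yu] := starR_repr_class u.
have Ay : A y.
  by apply/(internal_mem AS yu); apply: filterS nub => e /= /uP[].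
have xy : x < y.
  by apply/(starR_repr_lt xt yu); apply: filterS nub => e /= /uP[].
by have := lt_le_trans xy (Ax y Ay); rewrite ltxx.
Qed.

End RealNets.

Theorem theorem2p10p2 (R : realType) (U : set_system {posnum R})
    (UU : UltraFilter U)
    (U0 : forall n : nat, (0 < n)%N ->
      U [set e : {posnum R} | e%:num < n%:R^-1])
    (A : set (starR UU)) :
  A !=set0 -> internal [set starR_val x | x in A] -> has_ubound A ->
  exists s : starR UU, supremums A s.
Proof.
move=> [x Ax] [S AS] [b Ab].
have FU : ProperFilter U := @ultra_proper _ _ UU.
pose T e := [set r : R | S e r%:C%C].
have [t xt] := starR_repr_ex x; have [u bu] := starR_repr_ex b.
(* Where [T e] is empty or unbounded above, [sup] is a mere default; almost everywhere [t e] lies in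
   [T e] and [u e] bounds it, so [sup (T e)] is a true least upper bound. *)
have [s sT] := starR_repr_class (UU := UU) (fun e => sup (T e)).
exists s; split=> [y Ay|y Ay].
  have [v yv] := starR_repr_ex y; apply: (starR_repr_le yv sT).
  have Sv := (internal_mem AS yv).1 Ay.
  apply: filterS2 Sv (internal_ubound AS bu Ab) => e Sv Tu.
  by apply: ub_le_sup => //; exists (u e).
have [v yv] := starR_repr_ex y; apply: (starR_repr_le sT yv).
have St := (internal_mem AS xt).1 Ax.
apply: filterS2 St (internal_ubound AS yv Ay) => e St Tv.
by apply: ge_sup => //; exists (t e).
Qed.
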